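(* Let $f$ be a nonnegative function on $[0,1]^n$ for which $f^{1/n}\in C^{0,1}([0,1]^n)$, and let $w$ be the maximal bounded viscosity solution of (P3). Then $w\in C^{0,1}([0,1]^n)$ and $$[w]_{1;[0,1]^n}\le\sqrt{n}\,[f^{1/n}]_{1;[0,1]^n}.$$
   Context: $n\ge1$ is an integer, $a_+=\max(a,0)$, $\Gamma=\partial[0,1]^n\setminus(0,1]^n$, and $[g]_{1;[0,1]^n}=\sup_{x\ne y}|g(x)-g(y)|/|x-y|$ is the Lipschitz seminorm. A function is nondecreasing if it is nondecreasing in each coordinate separately. Problem (P1): $(u_{x_1})_+\cdots(u_{x_n})_+=f$ in $(0,1]^n$, $u=0$ on $\Gamma$. A viscosity solution of (P1) is a continuous $u:[0,1]^n\to\mathbb{R}$ with $u=0$ on $\Gamma$ such that for every $x_0\in(0,1]^n$ and every $C^1$ function $\phi$: if $u-\phi$ has a local maximum (resp. minimum) at $x_0$ relative to $(0,1]^n$, then $\prod_i(\phi_{x_i}(x_0))_+\le f(x_0)$ (resp. $\ge f(x_0)$). For continuous nonnegative $f$ there is a unique nondecreasing viscosity solution $u$ of (P1). Problem (P3): $\prod_{i=1}^n(w+nx_iw_{x_i})_+=f$ on $(0,1]^n$ (no boundary condition). The maximal bounded viscosity solution of (P3) is by definition $w(x)=n^{-1}(x_1\cdots x_n)^{-1/n}u(x)$, $x\in(0,1]^n$, where $u$ is the nondecreasing viscosity solution of (P1). The assertion $w\in C^{0,1}([0,1]^n)$ means that $w$ extends to a Lipschitz function on $[0,1]^n$. *)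

(* Defs.v *)
(* MathComp-Analysis, over an abstract [R : realType]; points of R^n are row
   vectors ['rV[R]_n]. Functions on a subset of R^n are represented by total
   functions, of which only the values on that subset are ever used. *)
From HB Require Import structures.
From mathcomp Require Import all_boot all_order all_algebra.
From mathcomp Require Import all_classical all_reals all_analysis.

Set Implicit Arguments.
Unset Strict Implicit.
Unset Printing Implicit Defensive.

Import Order.TTheory GRing.Theory Num.Theory.
Import numFieldNormedType.Exports.

Local Open Scope classical_set_scope.
Local Open Scope ring_scope.

Section Defs.
Context {R : realType} {n : nat}.
Implicit Types (A : set 'rV[R]_n) (f g u w phi : 'rV[R]_n -> R).

Definition cube : set 'rV[R]_n := [set x | forall i, 0 <= x ord0 i <= 1].

Definition cube_oc : set 'rV[R]_n := [set x | forall i, 0 < x ord0 i <= 1].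

(* The topological boundary of [0,1]^n, minus (0,1]^n. *)
Definition Gamma : set 'rV[R]_n := (closure cube `\` interior cube) `\` cube_oc.

(* The library norm on ['rV[R]_n] is the sup norm, hence this definition. *)
Definition enorm (x : 'rV[R]_n) : R := Num.sqrt (\sum_i (x ord0 i) ^+ 2).

(* Extended-real valued, so that it is [+oo] when [g] is not Lipschitz on [A]. *)
Definition lip_seminorm A g : \bar R :=
  ereal_sup [set r | exists x y, [/\ A x, A y, x != y &
                       r = (`|g x - g y| / enorm (x - y))%:E]].

Definition C01 A g : Prop := (lip_seminorm A g < +oo)%E.

Definition nondecreasing_on_coords A g : Prop :=
  forall (i : 'I_n) (x y : 'rV[R]_n), A x -> A y ->
    (forall j, j != i -> x ord0 j = y ord0 j) ->
    x ord0 i <= y ord0 i -> g x <= g y.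

Definition pderiv phi (i : 'I_n) (x : 'rV[R]_n) : R :=
  'D_(delta_mx ord0 i) phi x.

Definition C1 phi : Prop :=
  (forall x, differentiable phi x) /\ (forall i, continuous (pderiv phi i)).

Definition local_max_rel A g (x0 : 'rV[R]_n) : Prop :=
  \forall x \near within A (nbhs x0), g x <= g x0.

Definition local_min_rel A g (x0 : 'rV[R]_n) : Prop :=
  \forall x \near within A (nbhs x0), g x0 <= g x.

Definition P1_operator phi (x : 'rV[R]_n) : R :=
  \prod_(i < n) Num.max (pderiv phi i x) 0.

(* Viscosity solution of (u_{x_1})_+ ... (u_{x_n})_+ = f in (0,1]^n, with
   u = 0 on Gamma. *)
Definition viscosity_solution_P1 f u : Prop :=
  [/\ {within cube, continuous u},
      forall x, Gamma x -> u x = 0 &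
      forall x0 phi, cube_oc x0 -> C1 phi ->
        (local_max_rel cube_oc (fun x => u x - phi x) x0 ->
           P1_operator phi x0 <= f x0) /\
        (local_min_rel cube_oc (fun x => u x - phi x) x0 ->
           f x0 <= P1_operator phi x0)].

(* Maximal bounded viscosity solution of prod_i (w + n x_i w_{x_i})_+ = f on
   (0,1]^n, defined as w = n^-1 (x_1 ... x_n)^(-1/n) u where u is the
   nondecreasing viscosity solution of the problem above. *)
Definition maximal_bounded_solution_P3 f w : Prop :=
  exists u, [/\ viscosity_solution_P1 f u,
                nondecreasing_on_coords cube u &
                forall x, cube_oc x ->
                  w x = n%:R^-1 * (\prod_(i < n) x ord0 i) `^ (- n%:R^-1) * u x].

Definition nth_root f (x : 'rV[R]_n) : R := f x `^ n%:R^-1.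

End Defs.

(* Main.v *)
Require Import Defs.
From HB Require Import structures.
From mathcomp Require Import all_boot all_order all_algebra.
From mathcomp Require Import all_classical all_reals all_analysis.
From mathcomp Require Import ring lra.
Set Implicit Arguments.
Unset Strict Implicit.
Unset Printing Implicit Defensive.
Import Order.TTheory GRing.Theory Num.Theory.
Import numFieldNormedType.Exports.
Local Open Scope classical_set_scope.
Local Open Scope ring_scope.

(** The bound holds with constant [1] in place of [sqrt n].  Write [g] for
    [f^(1/n)] and [L] for its Lipschitz constant.  In

      prod_i (w + n x_i w_{x_i})_+ = f

    the unknown occurs undifferentiated and the derivatives occur only through
    [x_i w_{x_i}].  Double the variables: suppose that
    [w(x) - w(y) - k |x - y|^2] is maximal at [(x, y)].  Both points then see
    the slope [p = 2k(x - y)], so the sub- and supersolution tests give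

      prod_i (w(x) + n x_i p_i)_+ <= f(x),   f(y) <= prod_i (w(y) + n y_i p_i).

    The factors at [y] are nonnegative because [u] is nondecreasing, and each
    factor at [x] exceeds the one at [y] by
    [w(x) - w(y) + 2nk (x_i - y_i)^2 >= w(x) - w(y)].  The geometric mean is
    superadditive ([geometric_mean_shift]), hence
    [g(x) >= g(y) + w(x) - w(y)], that is [w(x) - w(y) <= L |x - y|].
    The quadratic penalty stands in for [L |x - y|] through Young's inequality
    [L d <= (L / 2r) d^2 + L r / 2], an equality for [d = r]; choosing [r] as
    the distance of a pair that violates the Lipschitz bound gives a
    contradiction ([P3_solution_lipschitz]).

    The maximum has to be attained in [(0,1]^n], where [w] is not controlled
    near the coordinate hyperplanes.  A term [e * sum_i ln x_i] pushes maximum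
    points away from them, and costs only [n e] in each factor since
    [x_i (ln x_i)' = 1].  This requires [w] to be bounded: comparing [u] with
    the strict supersolutions [n (M + 1) prod_i (x_i + s)^(1/n)], where
    [M^n >= f], gives [w <= 2 (M + 1)] ([P3_solution_le]).

    Test functions have to be [C^1] on the whole space, while the logarithm is
    not.  All those used here are of the form
    [exp (sum_i a_i(x_i)) * (c + sum_i b_i(x_i))], where the logarithm is
    replaced by its tangent line below a small positive level.

    Finally [w] is extended from [(0,1]^n] by McShane's formula
    ([lipschitz_extension]). *)

(** * Test functions built from one-variable functions *)

Definition separable_sum {R : realType} {n : nat} (h : 'I_n -> R -> R)
  (x : 'rV[R]_n) : R := \sum_i h i (x ord0 i).

Lemma is_diff_coord_comp {R : realType} {n : nat} (h : R -> R) (d : R)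
    (i : 'I_n) (x : 'rV[R]_n) :
  is_derive (x ord0 i) (1 : R) h d ->
  differentiable (fun y : 'rV[R]_n => h (y ord0 i)) x /\
  forall v : 'rV[R]_n,
    is_derive x v (fun y : 'rV[R]_n => h (y ord0 i)) (v ord0 i * d).
Proof.
move=> hd.
have dc : differentiable (fun y : 'rV[R]_n => y ord0 i) x.
  exact: differentiable_coord.
have dh : differentiable h (x ord0 i).
  by apply/derivable1_diffP; exact: ex_derive.
have dhc : differentiable (h \o (fun y : 'rV[R]_n => y ord0 i)) x.
  exact: differentiable_comp.
split=> // v; apply: DeriveDef; first exact: diff_derivable.
have lin : linear (fun y : 'rV[R]_n => y ord0 i).
  by move=> a y z; rewrite !mxE.
pose cM := GRing.isLinear.Build _ _ _ _ _ lin.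
pose c : {linear 'rV[R]_n -> R} := HB.pack (fun y : 'rV[R]_n => y ord0 i) cM.
have cc : continuous c by move=> z; exact: coord_continuous.
have dcv : 'd (fun y : 'rV[R]_n => y ord0 i) x v = v ord0 i.
  by rewrite -[X in diff _ X]/(c : _ -> _) diff_lin.
rewrite deriveE // diff_comp //= dcv.
by rewrite diff1E // derive1E derive_val.
Qed.

(** Only the summand of index [j] varies along the [j]-th basis vector. *)
Lemma is_diff_separable_sum {R : realType} {n : nat} (h dh : 'I_n -> R -> R)
    (x : 'rV[R]_n) :
  (forall i t, is_derive t (1 : R) (h i) (dh i t)) ->
  differentiable (separable_sum h) x /\
  forall j, is_derive x (delta_mx ord0 j : 'rV[R]_n) (separable_sum h)
              (dh j (x ord0 j)).
Proof.
move=> hd.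
have -> : separable_sum h = \sum_i (fun y : 'rV[R]_n => h i (y ord0 i)).
  by apply/funext => y; rewrite fct_sumE.
split=> [|j].
  apply: differentiable_sum => i.
  by have [] := is_diff_coord_comp (hd i (x ord0 i)).
rewrite (_ : dh j _ =
    \sum_i (delta_mx ord0 j : 'rV[R]_n) ord0 i * dh i (x ord0 i)).
  apply: is_derive_sum => i.
  by have [_] := is_diff_coord_comp (hd i (x ord0 i)).
rewrite (bigD1 j) //= big1 ?addr0 ?mxE ?eqxx ?mul1r // => i ij.
by rewrite mxE eqxx (negbTE ij) mul0r.
Qed.

(** With [a_i = (ln t) / n] the exponential is the geometric mean of the
    coordinates, which relates [u] to [w]; this one family covers the test
    functions of both equations and the barriers. *)
Definition exp_affine {R : realType} {n : nat} (a b : 'I_n -> R -> R) (c : R)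
  (x : 'rV[R]_n) : R := expR (separable_sum a x) * (c + separable_sum b x).

Section exp_affine_test.
Context {R : realType} {n : nat} (a da b db : 'I_n -> R -> R) (c : R).
Hypotheses (ha : forall i t, is_derive t (1 : R) (a i) (da i t))
  (hb : forall i t, is_derive t (1 : R) (b i) (db i t)).

Lemma differentiable_exp_affine (x : 'rV[R]_n) :
  differentiable (exp_affine a b c) x.
Proof.
have [dA _] := is_diff_separable_sum x ha.
have [dB _] := is_diff_separable_sum x hb.
apply: differentiableM.
  apply: (differentiable_comp dA).
  by apply/derivable1_diffP; exact: derivable_expR.
by apply: differentiableD => //; exact: differentiable_cst.
Qed.

Lemma pderiv_exp_affine (x : 'rV[R]_n) (j : 'I_n) :
  pderiv (exp_affine a b c) j x = expR (separable_sum a x) *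
    (da j (x ord0 j) * (c + separable_sum b x) + db j (x ord0 j)).
Proof.
have [dA /(_ j) eA] := is_diff_separable_sum x ha.
have [dB /(_ j) eB] := is_diff_separable_sum x hb.
have dE : differentiable (@expR R \o separable_sum a) x.
  apply: (differentiable_comp dA).
  by apply/derivable1_diffP; exact: derivable_expR.
have eE : is_derive x (delta_mx ord0 j : 'rV[R]_n) (@expR R \o separable_sum a)
    (expR (separable_sum a x) * da j (x ord0 j)).
  apply: DeriveDef; first exact: diff_derivable.
  have dexp : differentiable (@expR R) (separable_sum a x).
    by apply/derivable1_diffP; exact: derivable_expR.
  rewrite deriveE // diff_comp //= diff1E // derive1E derive_val.
  by rewrite -deriveE // derive_val mulrC.
have eC : is_derive x (delta_mx ord0 j : 'rV[R]_n) (cst c + separable_sum b)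
   (0 + db j (x ord0 j)) by exact: is_deriveD.
have := is_deriveM eE eC.
rewrite /pderiv => -[_]; rewrite /exp_affine.
rewrite -[(_ \o _) * _]/(fun y =>
  expR (separable_sum a y) * (c + separable_sum b y)).
move=> ->; rewrite /= /cst -[_ *: (_ + _)]/(_ * _) -[(_ + _) x *: _]/(_ * _).
rewrite -[(_ + _) x]/(c + _) add0r.
by ring.
Qed.

Hypotheses (cda : forall i, continuous (da i)) (cdb : forall i, continuous (db i)).

Lemma C1_exp_affine : C1 (exp_affine a b c).
Proof.
split=> [x|j]; first exact: differentiable_exp_affine.
rewrite (_ : pderiv _ j = fun x : 'rV[R]_n => expR (separable_sum a x) *
    (da j (x ord0 j) * (c + separable_sum b x) + db j (x ord0 j))); last first.
  by apply/funext => x; exact: pderiv_exp_affine.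
move=> x.
have cA : separable_sum a y @[y --> x] --> separable_sum a x.
  by apply: differentiable_continuous; have [] := is_diff_separable_sum x ha.
have cB : separable_sum b y @[y --> x] --> separable_sum b x.
  by apply: differentiable_continuous; have [] := is_diff_separable_sum x hb.
have cj (g : R -> R) : continuous g ->
    (fun y : 'rV[R]_n => g (y ord0 j)) @ x --> g (x ord0 j).
  move=> cg.
  have cx : (fun y : 'rV[R]_n => y ord0 j) @ x --> x ord0 j.
    exact: coord_continuous.
  exact: cvg_comp cx (cg _).
have cE : expR (separable_sum a y) @[y --> x] --> expR (separable_sum a x).
  exact: cvg_comp cA (@continuous_expR R _).
apply: (cvgM cE).
apply: cvgD; last exact: cj.
by apply: cvgM; [exact: cj | apply: cvgD => //; exact: cvg_cst].
Qed.

End exp_affine_test.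

(** * A logarithm continued by its tangent line *)

Lemma is_derive_cvg {R : realType} (f : R -> R) (c d : R) :
  is_derive c (1 : R) f d <->
  (fun h : R => h^-1 *: (f (h + c) - f c)) @ 0^' --> d.
Proof.
have E : (fun h : R => h^-1 *: ((f \o shift c) (h *: (1 : R)) - f c)) =
    (fun h : R => h^-1 *: (f (h + c) - f c)).
  by apply/funext => h /=; rewrite [h *: _]mulr1.
split=> [[+ <-]|fd].
  by rewrite /derivable /derive E => /cvgP; exact.
apply: DeriveDef; rewrite /derivable /derive E; first exact: cvgP fd.
exact: cvg_lim.
Qed.

(** Near [0] the difference quotient of the glued function is one of the two
    quotients, so it enters any neighbourhood that both of them enter. *)
Lemma is_derive_glue {R : realType} (f g : R -> R) (c d : R) :
  f c = g c -> is_derive c (1 : R) f d -> is_derive c (1 : R) g d ->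
  is_derive c (1 : R) (fun t => if c <= t then f t else g t) d.
Proof.
move=> fg /is_derive_cvg df /is_derive_cvg dg; apply/is_derive_cvg => U Ud.
have := df U Ud; have := dg U Ud; rewrite !nbhs_simpl /=.
apply: filterS2 => h /= gU fU; rewrite lexx; case: ifP => // _.
by rewrite fg.
Qed.

(** For [c > 0] this agrees with [ln] on [[c, +oo[] and is [C^1] on the whole
    line, so that test functions involving logarithms are globally [C^1]. *)
Definition ln_cutoff {R : realType} (c t : R) : R :=
  if c <= t then ln t else ln c + c^-1 * (t - c).

Lemma ln_cutoffE {R : realType} (c t : R) : c <= t -> ln_cutoff c t = ln t.
Proof. by rewrite /ln_cutoff => ->. Qed.

Lemma is_derive_ln_cutoff {R : realType} (c t : R) : 0 < c ->
  is_derive t (1 : R) (ln_cutoff c) (Num.max c t)^-1.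
Proof.
move=> c0.
have tangent s : is_derive s (1 : R) (fun t => ln c + c^-1 * (t - c)) c^-1.
  have -> : (fun t => ln c + c^-1 * (t - c)) =
      cst (ln c) + c^-1 *: (id - cst c) by apply/funext.
  apply: is_derive_eq.
  by rewrite add0r subr0 [LHS]mulr1.
have [tc|ct|->] := ltgtP t c.
- apply: near_eq_is_derive (tangent t); near=> s.
  rewrite /ln_cutoff leNgt ifF //; apply/negbTE; rewrite negbK; near: s.
  exact: lt_nbhsl.
- apply: near_eq_is_derive (is_derive1_ln (lt_trans c0 ct)); near=> s.
  by rewrite ln_cutoffE //; apply/ltW; near: s; exact: lt_nbhsr.
- apply: (is_derive_glue _ (is_derive1_ln c0) (tangent c)).
  by rewrite subrr mulr0 addr0.
Unshelve. all: by end_near. Qed.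

Lemma continuous_dln_cutoff {R : realType} (c : R) : 0 < c ->
  continuous (fun t : R => (Num.max c t)^-1).
Proof.
move=> c0 t; apply: cvgV; first by rewrite gt_eqF // lt_max c0.
by apply: (@continuous_max _ _ (cst c) id t) => //; exact: cvg_cst.
Qed.

(** * The Euclidean norm and Lipschitz seminorms *)

Lemma enorm_ge0 {R : realType} {n : nat} (x : 'rV[R]_n) : 0 <= enorm x.
Proof. exact: sqrtr_ge0. Qed.

Lemma enorm_sqr {R : realType} {n : nat} (x : 'rV[R]_n) :
  enorm x ^+ 2 = \sum_i x ord0 i ^+ 2.
Proof. by rewrite sqr_sqrtr // sumr_ge0 // => i _; rewrite sqr_ge0. Qed.

Lemma enorm_eq0 {R : realType} {n : nat} (x : 'rV[R]_n) : enorm x = 0 -> x = 0.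
Proof.
move=> x0; have := enorm_sqr x; rewrite x0 expr0n /= => /esym/eqP.
rewrite psumr_eq0 => [/allP h|i _]; last exact: sqr_ge0.
apply/rowP => i; rewrite mxE; apply/eqP.
by have := h i (mem_index_enum i); rewrite sqrf_eq0.
Qed.

Lemma enormB_gt0 {R : realType} {n : nat} (x y : 'rV[R]_n) :
  x != y -> 0 < enorm (x - y).
Proof.
move=> xy; rewrite lt_neqAle enorm_ge0 andbT eq_sym.
by apply: contra xy => /eqP/enorm_eq0/eqP; rewrite subr_eq0.
Qed.

Lemma enormN {R : realType} {n : nat} (x : 'rV[R]_n) : enorm (- x) = enorm x.
Proof. by congr Num.sqrt; apply: eq_bigr => i _; rewrite mxE sqrrN. Qed.

Lemma dot_le_enorm {R : realType} {n : nat} (x y : 'rV[R]_n) :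
  \sum_i x ord0 i * y ord0 i <= enorm x * enorm y.
Proof.
have [/eqP x0|x0] := boolP (enorm x == 0).
  by rewrite (enorm_eq0 x0) big1 ?mulr_ge0 ?enorm_ge0 // => i _; rewrite mxE mul0r.
have [/eqP y0|y0] := boolP (enorm y == 0).
  by rewrite (enorm_eq0 y0) big1 ?mulr_ge0 ?enorm_ge0 // => i _; rewrite mxE mulr0.
have xp : 0 < enorm x by rewrite lt_neqAle eq_sym x0 enorm_ge0.
have yp : 0 < enorm y by rewrite lt_neqAle eq_sym y0 enorm_ge0.
(* Sum the inequalities [0 <= (|y| x_i - |x| y_i)^2]. *)
have p2 : 0 < 2 * (enorm x * enorm y) by rewrite !mulr_gt0.
rewrite -(ler_pM2l p2).
have -> : 2 * (enorm x * enorm y) * (enorm x * enorm y) =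
    enorm y ^+ 2 * enorm x ^+ 2 + enorm x ^+ 2 * enorm y ^+ 2 by ring.
rewrite {1}[enorm x ^+ 2]enorm_sqr {2}[enorm y ^+ 2]enorm_sqr.
rewrite !mulr_sumr -big_split /=; apply: ler_sum => i _.
have := sqr_ge0 (enorm y * x ord0 i - enorm x * y ord0 i); lra.
Qed.

Lemma enormD {R : realType} {n : nat} (x y : 'rV[R]_n) :
  enorm (x + y) <= enorm x + enorm y.
Proof.
rewrite -(@ler_pXn2r _ 2) ?nnegrE ?addr_ge0 ?enorm_ge0 //.
have -> : enorm (x + y) ^+ 2 =
    enorm x ^+ 2 + enorm y ^+ 2 + 2 * \sum_i x ord0 i * y ord0 i.
  rewrite !enorm_sqr mulr_sumr -!big_split /=.
  by apply: eq_bigr => i _; rewrite mxE; ring.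
have := dot_le_enorm x y; lra.
Qed.

Lemma lip_seminorm_lipschitz {R : realType} {n : nat} (A : set 'rV[R]_n)
    (g : 'rV[R]_n -> R) (L : R) :
  lip_seminorm A g = L%:E ->
  forall x y, A x -> A y -> `|g x - g y| <= L * enorm (x - y).
Proof.
move=> gL x y Ax Ay; have [->|xy] := eqVneq x y.
  by rewrite !subrr normr0 /enorm big1 ?sqrtr0 ?mulr0 // => i _; rewrite mxE expr0n.
have exy := enormB_gt0 xy.
rewrite -ler_pdivrMr // -lee_fin -gL; apply: ereal_sup_ubound.
by exists x, y.
Qed.

Lemma lip_seminorm_le {R : realType} {n : nat} (A : set 'rV[R]_n)
    (g : 'rV[R]_n -> R) (L : R) :
  (forall x y, A x -> A y -> `|g x - g y| <= L * enorm (x - y)) ->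
  (lip_seminorm A g <= L%:E)%E.
Proof.
move=> gL; apply: ge_ereal_sup => _ [x [y [Ax Ay xy ->]]].
have exy := enormB_gt0 xy.
by rewrite lee_fin ler_pdivrMr // gL.
Qed.

Lemma lip_seminorm_cube_ge0 {R : realType} {n : nat} (g : 'rV[R]_n -> R) :
  (0 < n)%N -> (0 <= lip_seminorm cube g)%E.
Proof.
move=> n0; pose x : 'rV[R]_n := const_mx 0; pose y : 'rV[R]_n := const_mx 1.
apply: (@le_trans _ _ (`|g x - g y| / enorm (x - y))%:E).
  by rewrite lee_fin divr_ge0 // enorm_ge0.
apply: ereal_sup_ubound; exists x, y; split=> //.
- by move=> i; rewrite mxE lexx ler01.
- by move=> i; rewrite mxE lexx ler01.
- apply/eqP => /rowP /(_ (Ordinal n0)); rewrite !mxE => /eqP.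
  by rewrite eq_sym oner_eq0.
Qed.

(** McShane's formula [W x = inf_y (w y + L |x - y|)]: an infimum of
    [L]-Lipschitz functions is [L]-Lipschitz. *)
Lemma lipschitz_extension {R : realType} {n : nat} (A : set 'rV[R]_n)
    (w : 'rV[R]_n -> R) (L : R) : A !=set0 -> 0 <= L ->
  (forall x y, A x -> A y -> w x - w y <= L * enorm (x - y)) ->
  exists W : 'rV[R]_n -> R, (forall x, A x -> W x = w x) /\
    forall x y, `|W x - W y| <= L * enorm (x - y).
Proof.
move=> [a Aa] L0 wL.
pose E (x : 'rV[R]_n) := [set w y + L * enorm (x - y) | y in A].
have triangle (x y z : 'rV[R]_n) :
    L * enorm (x - z) <= L * enorm (x - y) + L * enorm (y - z).
  rewrite -mulrDr ler_wpM2l //.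
  by rewrite (_ : x - z = (x - y) + (y - z)) ?enormD // addrA subrK.
have E_inf x : has_inf (E x).
  split; first by exists (w a + L * enorm (x - a)), a.
  exists (w a - L * enorm (a - x)) => _ [y Ay <-].
  have := wL a y Aa Ay; have := triangle a x y; lra.
pose W x := inf (E x).
have W_le x y : A y -> W x <= w y + L * enorm (x - y).
  by move=> Ay; apply: ge_inf; [exact: (E_inf x).2|exists y].
have W_ge x b : (forall y, A y -> b <= w y + L * enorm (x - y)) -> b <= W x.
  move=> bE; apply: lb_le_inf; first exact: (E_inf x).1.
  by move=> _ [y Ay <-]; exact: bE.
have W_lip x y : W x - W y <= L * enorm (x - y).
  rewrite lerBlDl -lerBlDr; apply: W_ge => z Az.
  have := W_le x z Az; have := triangle x y z; lra.
exists W; split=> [x Ax|x y].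
  apply/eqP; rewrite eq_le; apply/andP; split.
    apply: le_trans (W_le x x Ax) _.
    rewrite subrr /enorm big1 ?sqrtr0 ?mulr0 ?addr0 // => i _.
    by rewrite mxE expr0n.
  by apply: W_ge => y Ay; have := wL x y Ax Ay; lra.
rewrite ler_norml W_lip andbT lerNl opprB -enormN opprB.
exact: W_lip.
Qed.

(** * Superadditivity of the geometric mean *)

(** [G] and [T] are the geometric means of the [a_i] and of the [a_i + b], up to
    the inequalities assumed.  By the arithmetic-geometric mean inequality,
    [G / T] and [b / T] are at most the averages of [a_i / (a_i + b)] and of
    [b / (a_i + b)], which add up to [1]. *)
Lemma geometric_mean_shift {R : realType} {n : nat} (a : 'I_n -> R) (b G T : R) :
  (0 < n)%N -> (forall i, 0 <= a i) -> 0 < b -> 0 <= G -> 0 <= T ->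
  G ^+ n <= \prod_i a i -> \prod_i (a i + b) <= T ^+ n -> G + b <= T.
Proof.
move=> n0 a0 b0 G0 T0 Ga abT.
have ab0 i : 0 < a i + b by rewrite ltr_wpDl.
have P0 : 0 < \prod_i (a i + b) by apply: prodr_gt0 => i _.
have Tp : 0 < T.
  rewrite lt_neqAle T0 andbT; apply/eqP => T00.
  by move: (lt_le_trans P0 abT); rewrite -T00 expr0n eqn0Ngt n0 ltxx.
have n0R : (0 : R) < n%:R by rewrite ltr0n.
have amgm (e : 'I_n -> R) (H : R) : (forall i, 0 <= e i) -> 0 <= H ->
    H ^+ n <= \prod_i e i -> H / T <= (\sum_i e i / (a i + b)) / n%:R.
  move=> e0 H0 He.
  have q0 i : 0 <= e i / (a i + b) by rewrite divr_ge0 // ltW.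
  rewrite -(@ler_pXn2r _ n) ?nnegrE ?divr_ge0 ?sumr_ge0 ?ler0n //.
  have [+ _] := leif_AGM (A := 'I_n) (E := fun i => e i / (a i + b))
    (fun i _ => q0 i).
  rewrite card_ord => avg; apply: le_trans avg.
  rewrite prodf_div expr_div_n ler_pdivrMr ?exprn_gt0 // mulrAC.
  rewrite ler_pdivlMr //; apply: ler_pM => //; rewrite ?exprn_ge0 //; exact: ltW.
have hG := amgm a G a0 G0 Ga.
have hb : b / T <= (\sum_i b / (a i + b)) / n%:R.
  apply: amgm => [i| |]; [exact: ltW | exact: ltW |].
  by rewrite prodr_const card_ord.
rewrite -[leRHS]mul1r -ler_pdivrMr // mulrDl.
apply: (le_trans (lerD hG hb)); rewrite -mulrDl -big_split /=.
rewrite (eq_bigr (fun=> 1)) => [|i _]; last by rewrite -mulrDl divff ?gt_eqF.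
by rewrite sumr_const card_ord divff // gt_eqF.
Qed.

(** * Weighted test functions for the equation of w *)

Definition log_quadratic {R : realType} {n : nat} (k e : R) (y x : 'rV[R]_n) : R :=
  \sum_i (k * (x ord0 i - y ord0 i) ^+ 2 + e * ln (x ord0 i)).

Definition geom_mean {R : realType} {n : nat} (x : 'rV[R]_n) : R :=
  expR (\sum_i n%:R^-1 * ln (x ord0 i)).

Lemma geom_mean_gt0 {R : realType} {n : nat} (x : 'rV[R]_n) : 0 < geom_mean x.
Proof. exact: expR_gt0. Qed.

Lemma geom_meanX {R : realType} {n : nat} (x : 'rV[R]_n) : (0 < n)%N ->
  (forall i, 0 < x ord0 i) -> geom_mean x ^+ n = \prod_i x ord0 i.
Proof.
move=> n0 x0; rewrite /geom_mean -expRM_natl -mulr_sumr mulrA.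
rewrite divff ?mul1r; last first.
  by rewrite pnatr_eq0 -lt0n.
by rewrite expR_sum; apply: eq_bigr => i _; rewrite lnK // posrE.
Qed.

Lemma geom_mean_powR {R : realType} {n : nat} (x : 'rV[R]_n) : (0 < n)%N ->
  (forall i, 0 < x ord0 i) ->
  (\prod_i x ord0 i) `^ (- n%:R^-1) = (geom_mean x)^-1.
Proof.
move=> n0 x0; rewrite -geom_meanX // powRN -powR_mulrn ?ltW ?geom_mean_gt0 //.
rewrite -powRrM divff ?powRr1 ?ltW ?geom_mean_gt0 //.
by rewrite pnatr_eq0 -lt0n.
Qed.

Lemma cube_oc_prod_le {R : realType} {n : nat} (x : 'rV[R]_n) (j : 'I_n) :
  cube_oc x -> \prod_i x ord0 i <= x ord0 j.
Proof.
move=> xc; rewrite (bigD1 j) //= ger_pMr; last by have /andP[] := xc j.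
by apply: prodr_ile1 => i _; have /andP[/ltW -> ->] := xc i.
Qed.

Lemma near_coord_gt {R : realType} {n : nat} (x0 : 'rV[R]_n) (c : R) :
  (forall i, c < x0 ord0 i) ->
  \forall x \near x0, forall i, c < (x : 'rV[R]_n) ord0 i.
Proof.
move=> cx; apply: (@filter_forall _ _
  (fun (i : 'I_n) (x : 'rV[R]_n) => c < x ord0 i) _ (nbhs_filter x0)) => i.
have ci : (fun x : 'rV[R]_n => x ord0 i) @ x0 --> x0 ord0 i.
  exact: coord_continuous.
exact: cvgr_gt ci _ (cx i).
Qed.

(** The function [u = n * geom_mean * w] is tested with the product of the same
    weight and a test function for [w]; the gradient of the weight turns
    [u_{x_i}] into [(geom_mean / x_i) * (w + n x_i w_{x_i})]. *)
Lemma log_quadratic_test {R : realType} {n : nat} (x0 y : 'rV[R]_n) (k e w0 : R) :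
  (0 < n)%N -> cube_oc x0 ->
  exists phi : 'rV[R]_n -> R, [/\ C1 phi,
    \forall x \near x0, phi x = n%:R * (geom_mean x *
       (w0 + (log_quadratic k e y x - log_quadratic k e y x0))) &
    forall i, pderiv phi i x0 = geom_mean x0 / x0 ord0 i *
       (w0 + n%:R * (2 * k * x0 ord0 i * (x0 ord0 i - y ord0 i) + e))].
Proof.
move=> n0 x0c.
have n0R : n%:R != 0 :> R by rewrite pnatr_eq0 -lt0n.
have x0p i : 0 < x0 ord0 i by have /andP[] := x0c i.
(* The product of the coordinates is at most each of them, so the cutoff level
   [c] is below all the coordinates of [x0], hence of nearby points. *)
pose c := (\prod_i x0 ord0 i) / 2.
have P0 : 0 < \prod_i x0 ord0 i by apply: prodr_gt0 => i _.
have c0 : 0 < c by rewrite divr_gt0.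
have cx i : c < x0 ord0 i.
  have := cube_oc_prod_le i x0c; rewrite /c; lra.
pose a (i : 'I_n) t := n%:R^-1 * ln_cutoff c t.
pose da (i : 'I_n) (t : R) := n%:R^-1 * (Num.max c t)^-1.
pose b (i : 'I_n) t := n%:R * (k * (t - y ord0 i) ^+ 2 + e * ln_cutoff c t).
pose db (i : 'I_n) (t : R) :=
  n%:R * (2 * k * (t - y ord0 i) + e * (Num.max c t)^-1).
have dl t := is_derive_ln_cutoff t c0.
have ha i t : is_derive t (1 : R) (a i) (da i t).
  have -> : a i = n%:R^-1 *: ln_cutoff c by apply/funext.
  by apply: is_deriveZ; exact: dl.
have hb i t : is_derive t (1 : R) (b i) (db i t).
  have -> : b i = n%:R *: (k *: (id - cst (y ord0 i)) ^+ 2 + e *: ln_cutoff c).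
    by apply/funext => s; rewrite /b /= !fctE.
  have := dl t => ?; apply: is_derive_eq.
  rewrite /db subr0 expr1 !scaler_nat; rewrite -![_ *: _]/(_ * _).
  rewrite -[(id - _) t]/(t - y ord0 i); ring.
have cda i : continuous (da i).
  by move=> t; apply: cvgM; [exact: cvg_cst | exact: continuous_dln_cutoff].
have cdb i : continuous (db i).
  move=> t; apply: cvgM; first exact: cvg_cst.
  apply: cvgD; apply: cvgM;
    [exact: cvg_cst| |exact: cvg_cst|exact: continuous_dln_cutoff].
  by apply: cvgD; [exact: cvg_id|exact: cvg_cst].
pose C := n%:R * (w0 - log_quadratic k e y x0).
have bE (x : 'rV[R]_n) : (forall i, c < x ord0 i) ->
    separable_sum b x = n%:R * log_quadratic k e y x.
  move=> xc; rewrite /log_quadratic mulr_sumr; apply: eq_bigr => i _.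
  by rewrite /b ln_cutoffE // ltW.
have aE (x : 'rV[R]_n) : (forall i, c < x ord0 i) ->
    expR (separable_sum a x) = geom_mean x.
  by move=> xc; congr expR; apply: eq_bigr => i _; rewrite /a ln_cutoffE // ltW.
exists (exp_affine a b C); split.
- exact: (C1_exp_affine C ha hb cda cdb).
- have := near_coord_gt cx; apply: filterS => x xc.
  by rewrite /exp_affine aE // bE // /C; ring.
- move=> i; rewrite (pderiv_exp_affine C ha hb) aE // bE // /da /db /C.
  rewrite max_r ?ltW //.
  by field; rewrite n0R gt_eqF.
Qed.

(** The weights [geom_mean / x_i] multiply to [1]. *)
Lemma P1_operator_test {R : realType} {n : nat} (phi : 'rV[R]_n -> R)
    (x0 : 'rV[R]_n) (F : 'I_n -> R) : (0 < n)%N -> cube_oc x0 ->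
  (forall i, pderiv phi i x0 = geom_mean x0 / x0 ord0 i * F i) ->
  P1_operator phi x0 = \prod_i Num.max (F i) 0.
Proof.
move=> n0 x0c E.
have x0p i : 0 < x0 ord0 i by have /andP[] := x0c i.
rewrite /P1_operator.
rewrite (eq_bigr (fun i => geom_mean x0 / x0 ord0 i * Num.max (F i) 0)); last first.
  by move=> i _; rewrite E maxr_pMr ?mulr0 // divr_ge0 ?ltW // geom_mean_gt0.
rewrite big_split /= prodf_div prodr_const card_ord geom_meanX //.
by rewrite divff ?mul1r //; apply/prodf_neq0 => i _; rewrite gt_eqF.
Qed.

Lemma cvg_shift_left {R : realType} {n : nat} (x v : 'rV[R]_n) :
  (fun h : R => h *: v + x) @ (0 : R)^'- --> x.
Proof.
apply: cvg_at_left_filter.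
rewrite -[X in _ --> X]add0r -(scale0r v).
by apply: cvgD; [apply: cvgZl; exact: cvg_id | exact: cvg_cst].
Qed.

(** A short move back along the [i]-th axis stays in [(0,1]^n] and does not
    increase [u]; since [u - phi] does not decrease, [phi] does not increase.
    Forward moves may leave the cube, so only the left difference quotient is
    used. *)
Lemma pderiv_ge0_at_min {R : realType} {n : nat} (u phi : 'rV[R]_n -> R)
    (x0 : 'rV[R]_n) (i : 'I_n) :
  nondecreasing_on_coords cube u -> cube_oc x0 -> differentiable phi x0 ->
  local_min_rel cube_oc (fun x => u x - phi x) x0 -> 0 <= pderiv phi i x0.
Proof.
move=> u_nd x0c dphi; rewrite /local_min_rel near_withinE => hmin.
rewrite leNgt; apply/negP => neg.
pose v : 'rV[R]_n := delta_mx ord0 i.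
pose q (h : R) := h^-1 *: ((phi \o shift x0) (h *: v) - phi x0).
have x0i : 0 < x0 ord0 i by have /andP[] := x0c i.
have qlim : q h @[h --> (0 : R)^'] --> pderiv phi i x0.
  have := diff_derivable (v := v) dphi.
  by rewrite /derivable /pderiv /derive; exact.
have qneg : \forall h \near (0 : R)^', q h < 0 by exact: cvgr_lt qlim _ neg.
have {}qneg : \forall h \near (0 : R)^'-, q h < 0.
  move: qneg; rewrite !near_withinE; apply: filterS => h + h0; apply.
  by rewrite lt_eqF.
have shift_cvg := @cvg_shift_left R n x0 v.
have hminh : \forall h \near (0 : R)^'-, cube_oc (h *: v + x0) ->
    u x0 - phi x0 <= u (h *: v + x0) - phi (h *: v + x0).
  exact: shift_cvg hmin.
have hlow : \forall h \near (0 : R)^'-, - x0 ord0 i < h.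
  by apply: nbhs_left_gt; rewrite oppr_lt0.
have hlt0 : \forall h \near (0 : R)^'-, h < 0 by exact: nbhs_left_lt.
have [h [qh mh h_low h0]] : exists h : R, [/\ q h < 0, cube_oc (h *: v + x0) ->
    u x0 - phi x0 <= u (h *: v + x0) - phi (h *: v + x0), - x0 ord0 i < h & h < 0].
  near (0 : R)^'- => h; exists h; split; first (by near: h);
    [by near: h | by near: h | by near: h].
have coordE j : (h *: v + x0) ord0 j = (if j == i then h else 0) + x0 ord0 j.
  by rewrite !mxE eqxx /=; case: eqP => _; rewrite ?mulr1 ?mulr0.
have hc : cube_oc (h *: v + x0).
  move=> j; rewrite coordE; have /andP[x0j x1j] := x0c j.
  by case: eqP => [->|_]; [have /andP[] := x0c i|]; lra.
have uh : u (h *: v + x0) <= u x0.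
  have sub z : cube_oc z -> cube z by move=> zc j; have /andP[/ltW -> ->] := zc j.
  apply: (u_nd i); [exact: sub|exact: sub| |].
    by move=> j /negbTE ji; rewrite coordE ji add0r.
  by rewrite coordE eqxx; lra.
have := mh hc; move: qh; rewrite /q /= -[_ *: _]/(_ * _) nmulr_rlt0 ?invr_lt0 //.
lra.
Unshelve. all: by end_near. Qed.

(** * Viscosity tests for w *)

Lemma cube_oc_sub {R : realType} {n : nat} (x : 'rV[R]_n) : cube_oc x -> cube x.
Proof. by move=> xc i; have /andP[/ltW -> ->] := xc i. Qed.

Section solution.
Context {R : realType} {n : nat} (f u w : 'rV[R]_n -> R).
Hypotheses (hn : (0 < n)%N) (hu : viscosity_solution_P1 f u)
  (u_nd : nondecreasing_on_coords cube u)
  (hw : forall x, cube_oc x ->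
     w x = n%:R^-1 * (\prod_(i < n) x ord0 i) `^ (- n%:R^-1) * u x).

Lemma solution_P3E x : cube_oc x -> u x = n%:R * (geom_mean x * w x).
Proof.
move=> xc; rewrite hw // geom_mean_powR // => [|i]; last by have /andP[] := xc i.
by field; rewrite pnatr_eq0 -lt0n hn gt_eqF // geom_mean_gt0.
Qed.

Let weight_gt0 (x : 'rV[R]_n) : 0 < n%:R * geom_mean x :> R.
Proof. by rewrite mulr_gt0 ?ltr0n ?geom_mean_gt0. Qed.

Lemma P3_subsolution_test (k e : R) (x0 y : 'rV[R]_n) : cube_oc x0 ->
  local_max_rel cube_oc (fun x => w x - log_quadratic k e y x) x0 ->
  \prod_i Num.max
    (w x0 + n%:R * (2 * k * x0 ord0 i * (x0 ord0 i - y ord0 i) + e)) 0 <= f x0.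
Proof.
move=> x0c hmax; have [_ _ /(_ x0) test] := hu.
have [phi [phiC1 phiE dphi]] := log_quadratic_test y k e (w x0) hn x0c.
rewrite -(P1_operator_test hn x0c dphi); have [+ _] := test phi x0c phiC1; apply.
move: hmax; rewrite /local_max_rel !near_withinE.
have phi0 := nbhs_singleton phiE; move: phiE; apply: filterS2 => x phix hx xc.
rewrite !solution_P3E // phix phi0 subrr addr0 subrr.
have := hx xc; rewrite mulrA mulrA -mulrBr pmulr_rle0 // => ?; lra.
Qed.

(** Monotonicity of [u] makes every factor nonnegative, so the positive parts
    disappear.  This matters where [f] vanishes: the product alone says nothing
    there about the signs of its factors. *)
Lemma P3_supersolution_test (k e : R) (x0 y : 'rV[R]_n) : cube_oc x0 ->
  local_min_rel cube_oc (fun x => w x - log_quadratic k e y x) x0 ->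
  let F i := w x0 + n%:R * (2 * k * x0 ord0 i * (x0 ord0 i - y ord0 i) + e) in
  (forall i, 0 <= F i) /\ f x0 <= \prod_i F i.
Proof.
move=> x0c hmin F; have [_ _ /(_ x0) test] := hu.
have [phi [phiC1 phiE dphi]] := log_quadratic_test y k e (w x0) hn x0c.
have umin : local_min_rel cube_oc (fun x => u x - phi x) x0.
  move: hmin; rewrite /local_min_rel !near_withinE.
  have phi0 := nbhs_singleton phiE; move: phiE; apply: filterS2 => x phix hx xc.
  rewrite !solution_P3E // phix phi0 subrr addr0 subrr.
  have := hx xc; rewrite mulrA mulrA -mulrBr pmulr_rge0 // => ?; lra.
have F0 i : 0 <= F i.
  have := pderiv_ge0_at_min i u_nd x0c (phiC1.1 x0) umin.
  have /andP[x0i _] := x0c i.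
  by rewrite dphi pmulr_rge0 // divr_gt0 // geom_mean_gt0.
split=> //; have [_ /(_ umin)] := test phi x0c phiC1.
rewrite (P1_operator_test hn x0c dphi).
by under eq_bigr => i _ do rewrite max_l ?F0 //.
Qed.

(** Points arbitrarily close to [x] have a negative [i]-th coordinate, so [x] is
    not interior to the cube. *)
Lemma Gamma_coord0 (x : 'rV[R]_n) (i : 'I_n) : cube x -> x ord0 i = 0 -> Gamma x.
Proof.
move=> xc xi; split; last by move=> /(_ i); rewrite xi ltxx.
split; first exact: subset_closure.
move=> xint.
pose v : 'rV[R]_n := delta_mx ord0 i.
have shift_cvg := @cvg_shift_left R n x v.
have hc : \forall h \near (0 : R)^'-, cube (h *: v + x) by exact: shift_cvg xint.
have hlt0 : \forall h \near (0 : R)^'-, h < 0 by exact: nbhs_left_lt.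
near (0 : R)^'- => h.
have h0 : h < 0 by near: h.
have : cube (h *: v + x) by near: h.
by move=> /(_ i); rewrite !mxE !eqxx /= mulr1 xi addr0 leNgt h0.
Unshelve. all: by end_near. Qed.

Lemma cube_not_oc (x : 'rV[R]_n) : cube x -> ~ cube_oc x -> u x = 0.
Proof.
move=> xc xnc; have [_ u0 _] := hu.
have [i xi] : exists i, ~ (0 < x ord0 i <= 1) by apply/existsNP.
apply/u0/(@Gamma_coord0 _ i) => //; have /andP[x0 x1] := xc i.
by apply/eqP; apply: contra_notT xi => xi; rewrite lt_neqAle eq_sym xi x0.
Qed.

(** Setting one coordinate to [0] lands on [Gamma], where [u] vanishes. *)
Lemma solution_ge0 x : cube x -> 0 <= u x.
Proof.
move=> xc; pose i := Ordinal hn.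
pose x' : 'rV[R]_n := \row_j (if j == i then 0 else x ord0 j).
have x'c : cube x'.
  by move=> j; rewrite mxE; case: eqP => _; [rewrite lexx ler01|exact: xc].
have [_ u0 _] := hu.
rewrite -(u0 x'); last by apply: (Gamma_coord0 (i := i)); rewrite // mxE eqxx.
apply: (u_nd (i := i)) => //; rewrite ?mxE ?eqxx; last by have /andP[] := xc i.
by move=> j /negbTE ji; rewrite mxE ji.
Qed.

Lemma P3_solution_ge0 x : cube_oc x -> 0 <= w x.
Proof.
move=> xc; have := solution_ge0 (cube_oc_sub xc).
by rewrite solution_P3E // mulrA pmulr_rge0.
Qed.

End solution.

(** * Boundedness of w *)

Lemma is_derive_translate {R : realType} (g : R -> R) (s t d : R) :
  is_derive (t + s) (1 : R) g d -> is_derive t (1 : R) (fun r => g (r + s)) d.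
Proof.
move=> /is_derive_cvg gd; apply/is_derive_cvg.
by under eq_fun do rewrite -addrA.
Qed.

Lemma box_compact {R : realType} {n : nat} (a b : R) :
  compact [set x : 'rV[R]_n | forall i, a <= x ord0 i <= b].
Proof.
have := @rV_compact R n (fun=> `[a, b]%classic) (fun=> @segment_compact R a b).
congr compact; apply/seteqP; split=> x /= h i; have := h i; by rewrite in_itv.
Qed.

Section upper_bound.
Context {R : realType} {n : nat} (f u w : 'rV[R]_n -> R) (M : R).
Hypotheses (hn : (0 < n)%N) (hu : viscosity_solution_P1 f u)
  (hw : forall x, cube_oc x ->
     w x = n%:R^-1 * (\prod_(i < n) x ord0 i) `^ (- n%:R^-1) * u x)
  (M0 : 0 <= M) (fM : forall x, cube_oc x -> f x <= M ^+ n).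

(** The barrier [v = n (M + 1) prod_i (x_i + s)^(1/n)] is positive on [Gamma],
    smooth up to it thanks to [s > 0], and the positive parts of its partial
    derivatives multiply to [(M + 1)^n > f].  So [u - v] cannot have a positive
    maximum. *)
Lemma P1_solution_le_barrier (s : R) (x : 'rV[R]_n) : 0 < s -> cube x ->
  u x <= n%:R * (M + 1) * expR (\sum_i n%:R^-1 * ln (x ord0 i + s)).
Proof.
move=> s0 xc.
have n0R : n%:R != 0 :> R by rewrite pnatr_eq0 -lt0n.
pose a (i : 'I_n) t := n%:R^-1 * ln_cutoff s (t + s).
pose da (i : 'I_n) (t : R) := n%:R^-1 * (Num.max s (t + s))^-1.
pose b (i : 'I_n) (t : R) : R := 0.
have ha i t : is_derive t (1 : R) (a i) (da i t).
  have := is_derive_translate (is_derive_ln_cutoff (t + s) s0) => ?.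
  have -> : a i = n%:R^-1 *: (fun r => ln_cutoff s (r + s)) by apply/funext.
  exact: is_deriveZ.
have hb i t : is_derive t (1 : R) (b i) (b i t) by exact: is_derive_cst.
have cda i : continuous (da i).
  move=> t; apply: cvgM; first exact: cvg_cst.
  have ts : r + s @[r --> t] --> t + s.
    by apply: cvgD; [exact: cvg_id|exact: cvg_cst].
  exact: cvg_comp ts (continuous_dln_cutoff s0 (x := t + s)).
have cdb i : continuous (b i) by move=> t; exact: cvg_cst.
pose v := exp_affine a b (n%:R * (M + 1)).
have vE z : cube z -> v z = n%:R * (M + 1) *
    expR (\sum_i n%:R^-1 * ln (z ord0 i + s)).
  move=> zc; rewrite /v /exp_affine [separable_sum b z]big1 // addr0 mulrC.
  congr (_ * expR _); apply: eq_bigr => i _.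
  by rewrite /a ln_cutoffE // lerDr; have /andP[] := zc i.
have vC1 : C1 v by exact: C1_exp_affine ha hb cda cdb.
have M1 : 0 < M + 1 by rewrite ltr_wpDl.
have v0 z : cube z -> 0 < v z.
  by move=> zc; rewrite vE // mulr_gt0 ?expR_gt0 // mulr_gt0 ?ltr0n.
rewrite -vE //.
have [z zc zmax] : exists2 z, z \in cube &
    forall y, y \in cube -> u y - v y <= u z - v z.
  apply: compact_EVT_max; first by exists x.
    exact: box_compact.
  have [/subspace_continuousP cu _ _] := hu.
  apply/subspace_continuousP => y yc; apply: cvgB; first exact: cu.
  apply: cvg_within_filter; apply: differentiable_continuous.
  exact: vC1.1.
have {}zc : cube z by rewrite inE in zc.
have [uv|uv] := leP (u z) (v z).
  have := zmax x; rewrite inE => /(_ xc). lra.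
have zoc : cube_oc z.
  apply: contrapT => znoc; move: uv (v0 z zc); rewrite (cube_not_oc hu zc znoc).
  lra.
have [_ _ /(_ z v zoc vC1)[+ _]] := hu.
have zmaxl : local_max_rel cube_oc (fun y => u y - v y) z.
  rewrite /local_max_rel near_withinE; apply: filterE => y yoc.
  by apply: zmax; rewrite inE; exact: cube_oc_sub.
move=> /(_ zmaxl) /le_trans /(_ (fM zoc)).
pose y : 'rV[R]_n := \row_i (z ord0 i + s).
have y0 i : 0 < y ord0 i by rewrite mxE addr_gt0 //; have /andP[] := zoc i.
rewrite /P1_operator.
have -> : \prod_(i < n) Num.max (pderiv v i z) 0 =
    \prod_i (geom_mean y / y ord0 i * (M + 1)).
  apply: eq_bigr => i _.
  rewrite (pderiv_exp_affine _ ha hb) [separable_sum b z]big1 // /b !addr0.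
  have -> : expR (separable_sum a z) = geom_mean y.
    congr expR; apply: eq_bigr => j _; rewrite /a mxE ln_cutoffE // lerDr.
    by have /andP[] := zc j.
  have zi : s <= z ord0 i + s by rewrite lerDr; have /andP[] := zc i.
  rewrite /da (max_r zi) mxE.
  rewrite max_l.
    by field; rewrite n0R gt_eqF //; have := y0 i; rewrite mxE.
  have := y0 i; rewrite mxE => yi.
  by rewrite !mulr_ge0 ?invr_ge0 ?ltW ?geom_mean_gt0 ?ltr0n.
rewrite big_split /= prodf_div !prodr_const card_ord geom_meanX //.
rewrite divff ?mul1r; last by apply/prodf_neq0 => i _; rewrite gt_eqF.
rewrite ler_pXn2r ?nnegrE //; lra.
Qed.

(** The barrier is used at a single point: with [s <= x_i] for all [i], its
    geometric mean is at most twice that of the [x_i]. *)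
Lemma P3_solution_le x : cube_oc x -> w x <= 2 * (M + 1).
Proof.
move=> xoc; pose s := \prod_i x ord0 i.
have x0 i : 0 < x ord0 i by have /andP[] := xoc i.
have s0 : 0 < s by apply: prodr_gt0.
have nR : 0 < n%:R :> R by rewrite ltr0n.
have := P1_solution_le_barrier s0 (cube_oc_sub xoc).
rewrite (solution_P3E hn hw) // -mulrA ler_pM2l // => /le_trans ub.
have -> : (w x <= 2 * (M + 1)) =
    (geom_mean x * w x <= (M + 1) * (2 * geom_mean x)).
  rewrite -[RHS](ler_pM2l (_ : 0 < (geom_mean x)^-1)) ?invr_gt0 ?geom_mean_gt0 //.
  by congr (_ <= _); field; rewrite gt_eqF // geom_mean_gt0.
apply: ub.
rewrite ler_pM2l; last by rewrite ltr_wpDl.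
have -> : 2 * geom_mean x = expR (\sum_i n%:R^-1 * ln (2 * x ord0 i)).
  rewrite (eq_bigr (fun i => n%:R^-1 * ln 2 + n%:R^-1 * ln (x ord0 i))).
    have avg2 : \sum_(i < n) n%:R^-1 * ln 2 = ln 2 :> R.
      by rewrite sumr_const card_ord -[LHS]mulr_natl mulrA divff ?mul1r ?gt_eqF.
    by rewrite big_split /= avg2 expRD lnK // posrE.
  by move=> i _; rewrite lnM ?posrE // mulrDr.
rewrite ler_expR; apply: ler_sum => i _.
rewrite ler_pM2l ?invr_gt0 // ler_ln ?posrE ?mulr_gt0 ?addr_gt0 //.
have := cube_oc_prod_le i xoc; rewrite -/s; lra.
Qed.

End upper_bound.

(** * Doubling of variables *)

Definition log_sum {R : realType} {n : nat} (x : 'rV[R]_n) : R :=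
  \sum_i ln (x ord0 i).

Lemma log_quadraticE {R : realType} {n : nat} (k e : R) (y x : 'rV[R]_n) :
  log_quadratic k e y x = k * enorm (x - y) ^+ 2 + e * log_sum x.
Proof.
rewrite enorm_sqr !mulr_sumr -big_split /=.
by apply: eq_bigr => i _; rewrite !mxE.
Qed.

Lemma log_sum_le {R : realType} {n : nat} (x : 'rV[R]_n) (i : 'I_n) :
  cube_oc x -> log_sum x <= ln (x ord0 i).
Proof.
move=> xc; rewrite /log_sum (bigD1 i) //= gerDl; apply: sumr_le0 => j _.
by rewrite ln_le0 //; have /andP[] := xc j.
Qed.

Lemma log_sum_le0 {R : realType} {n : nat} (x : 'rV[R]_n) :
  cube_oc x -> log_sum x <= 0.
Proof.
by move=> xc; apply: sumr_le0 => j _; rewrite ln_le0 //; have /andP[] := xc j.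
Qed.

Lemma continuous_within_fst {T U : topologicalType} {V : topologicalType}
    (A : set T) (B : set U) (h : T -> V) :
  {within A, continuous h} -> {within A `*` B, continuous (fun p => h p.1)}.
Proof.
move=> /subspace_continuousP ch; apply/subspace_continuousP => p [pA _] W hW.
have := ch _ pA W hW; rewrite /= !near_simpl => hA.
have : \forall q \near p, A q.1 -> W (h q.1).
  exact: (@cvg_fst _ _ (nbhs p.1) (nbhs p.2) _ _ hA).
by apply: filterS => q qW [qA _]; exact: qW.
Qed.

Lemma continuous_within_snd {T U : topologicalType} {V : topologicalType}
    (A : set T) (B : set U) (h : U -> V) :
  {within B, continuous h} -> {within A `*` B, continuous (fun p => h p.2)}.
Proof.
move=> /subspace_continuousP ch; apply/subspace_continuousP => p [_ pB] W hW.
have := ch _ pB W hW; rewrite /= !near_simpl => hB.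
have : \forall q \near p, B q.2 -> W (h q.2).
  exact: (@cvg_snd _ _ (nbhs p.1) (nbhs p.2) _ _ hB).
by apply: filterS => q qW [_ qB]; exact: qW.
Qed.

Lemma continuous_log_sum {R : realType} {n : nat} (c : R) : 0 < c ->
  {within [set x : 'rV[R]_n | forall i, c <= x ord0 i <= 1], continuous log_sum}.
Proof.
move=> c0.
have dl (i : 'I_n) t := is_derive_ln_cutoff t c0.
apply: (@subspace_eq_continuous _ _ _ (separable_sum (fun=> ln_cutoff c))).
  move=> x; rewrite inE => xK; apply: eq_bigr => i _.
  by rewrite ln_cutoffE //; have /andP[] := xK i.
apply: continuous_subspaceT => x; apply: differentiable_continuous.
by have [] := is_diff_separable_sum x dl.
Qed.

Lemma continuous_enorm_sqr {R : realType} {n : nat} :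
  continuous (fun x : 'rV[R]_n => enorm x ^+ 2).
Proof.
have dsq (i : 'I_n) (t : R) : is_derive t (1 : R) (fun r : R => r ^+ 2) (2 * t).
  have -> : (fun r : R => r ^+ 2) = (id ^+ 2) by [].
  apply: is_derive_eq; rewrite /= expr1 -[_ *: _]/(_ * _); ring.
rewrite (_ : (fun x => _) = separable_sum (fun=> fun r => r ^+ 2)); last first.
  by apply/funext => x; rewrite enorm_sqr.
move=> x; apply: differentiable_continuous.
by have [] := is_diff_separable_sum x dsq.
Qed.

Section comparison.
Context {R : realType} {n : nat} (f g u w : 'rV[R]_n -> R) (L : R).
Hypotheses (hn : (0 < n)%N) (hu : viscosity_solution_P1 f u)
  (u_nd : nondecreasing_on_coords cube u)
  (hw : forall x, cube_oc x ->
     w x = n%:R^-1 * (\prod_(i < n) x ord0 i) `^ (- n%:R^-1) * u x)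
  (g0 : forall x, cube_oc x -> 0 <= g x)
  (gf : forall x, cube_oc x -> g x ^+ n = f x)
  (L0 : 0 <= L)
  (gL : forall x y, cube_oc x -> cube_oc y -> `|g x - g y| <= L * enorm (x - y)).

Lemma continuous_P3_solution (c : R) : 0 < c ->
  {within [set x : 'rV[R]_n | forall i, c <= x ord0 i <= 1], continuous w}.
Proof.
move=> c0; pose K := [set x : 'rV[R]_n | forall i, c <= x ord0 i <= 1].
have Koc : K `<=` cube_oc.
  by move=> x xK i; have /andP[/(lt_le_trans c0) -> ->] := xK i.
have [cu _ _] := hu.
have {}cu : {within K, continuous u}.
  by apply: continuous_subspaceW cu => x /Koc/cube_oc_sub.
apply: (@subspace_eq_continuous _ _ _
    (fun x => (n%:R * expR (n%:R^-1 * log_sum x))^-1 * u x)).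
  move=> x; rewrite inE => /Koc xc; rewrite (solution_P3E hn hw) //.
  have -> : expR (n%:R^-1 * log_sum x) = geom_mean x.
    by rewrite /geom_mean -mulr_sumr.
  rewrite -[RHS]/(w x).
  by field; rewrite pnatr_eq0 -lt0n hn gt_eqF // geom_mean_gt0.
apply/subspace_continuousP => x xK.
apply: cvgM; last by move/subspace_continuousP : cu; exact.
have nR : 0 < n%:R :> R by rewrite ltr0n.
apply: cvgV; first by rewrite gt_eqF // mulr_gt0 ?expR_gt0.
apply: cvgM; first exact: cvg_cst.
have cl : (fun y => n%:R^-1 * log_sum y) @ within K (nbhs x) -->
    n%:R^-1 * log_sum x.
  apply: cvgM; first exact: cvg_cst.
  by move/subspace_continuousP : (@continuous_log_sum R n c c0); exact.
exact: cvg_comp cl (@continuous_expR R _).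
Qed.

(** The logarithms make [Phi] nonpositive as soon as one coordinate is below
    [exp (- M / e)]; so it is enough to maximize over a compact box. *)
Lemma P3_solution_doubling (M k e : R) (x1 y1 : 'rV[R]_n) :
  0 <= k -> 0 < e -> (forall x, cube_oc x -> w x <= M) ->
  cube_oc x1 -> cube_oc y1 ->
  let Phi x y := w x - w y - k * enorm (x - y) ^+ 2 +
                 e * log_sum x + e * log_sum y in
  0 < Phi x1 y1 ->
  exists x0 y0, [/\ cube_oc x0, cube_oc y0, Phi x1 y1 <= Phi x0 y0,
    forall x, cube_oc x -> Phi x y0 <= Phi x0 y0 &
    forall y, cube_oc y -> Phi x0 y <= Phi x0 y0].
Proof.
move=> k0 e0 wM x1c y1c Phi Phi1.
have w0 x : cube_oc x -> 0 <= w x by exact: P3_solution_ge0 hn hu u_nd hw x.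
have M0 : 0 <= M by exact: le_trans (w0 _ x1c) (wM _ x1c).
pose c := expR (- (M / e)).
have c0 : 0 < c by exact: expR_gt0.
pose K := [set x : 'rV[R]_n | forall i, c <= x ord0 i <= 1].
have Koc : K `<=` cube_oc.
  by move=> x xK i; have /andP[/(lt_le_trans c0) -> ->] := xK i.
have small x i : cube_oc x -> x ord0 i < c -> e * log_sum x <= - M.
  move=> xc xi; have /andP[xi0 _] := xc i.
  have lx : log_sum x <= - (M / e).
    apply: le_trans (log_sum_le i xc) _.
    by rewrite -[leRHS]expRK ler_ln ?posrE ?expR_gt0 // ltW.
  by move: lx; rewrite -mulNr ler_pdivlMr // mulrC.
have nonpos x y : cube_oc x -> cube_oc y ->
    e * log_sum x <= - M \/ e * log_sum y <= - M -> Phi x y <= 0.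
  move=> xc yc h; rewrite /Phi.
  have := wM x xc; have := w0 y yc.
  have : e * log_sum x <= 0 by rewrite pmulr_rle0 // log_sum_le0.
  have : e * log_sum y <= 0 by rewrite pmulr_rle0 // log_sum_le0.
  have : 0 <= k * enorm (x - y) ^+ 2 by rewrite mulr_ge0 // sqr_ge0.
  by case: h; lra.
have inK x y : cube_oc x -> cube_oc y -> 0 < Phi x y -> K x /\ K y.
  move=> xc yc P; split=> i; apply/andP; split;
    [|by have /andP[] := xc i| |by have /andP[] := yc i];
    rewrite leNgt; apply/negP => lt; move: P; apply/negP; rewrite -leNgt;
    apply: nonpos => //; [left|right]; exact: small lt.
have [x1K y1K] := inK _ _ x1c y1c Phi1.
have cPhi : {within K `*` K, continuous (fun p => Phi p.1 p.2)}.
  have cw := continuous_P3_solution c0.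
  have cl := @continuous_log_sum R n c c0.
  apply/subspace_continuousP => p pK.
  apply: cvgD; last first.
    apply: cvgM; first exact: cvg_cst.
    by move/subspace_continuousP : (continuous_within_snd (A := K) cl); exact.
  apply: cvgD; last first.
    apply: cvgM; first exact: cvg_cst.
    by move/subspace_continuousP : (continuous_within_fst (B := K) cl); exact.
  apply: cvgB.
    apply: cvgB.
      by move/subspace_continuousP : (continuous_within_fst (B := K) cw); exact.
    by move/subspace_continuousP : (continuous_within_snd (A := K) cw); exact.
  apply: cvgM; first exact: cvg_cst.
  apply: cvg_within_filter.
  have csub : (fun q : 'rV[R]_n * 'rV[R]_n => q.1 - q.2) @ p --> p.1 - p.2.
    by apply: cvgB; [exact: cvg_fst|exact: cvg_snd].
  exact: cvg_comp csub (@continuous_enorm_sqr R n _).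
have [[x0 y0] /=] := compact_EVT_max (A := K `*` K)
  (ex_intro _ (x1, y1) (conj x1K y1K))
  (compact_setX (@box_compact R n c 1) (@box_compact R n c 1)) cPhi.
rewrite inE => -[/= x0K y0K] Phi_max.
have max0 x y : K x -> K y -> Phi x y <= Phi x0 y0.
  by move=> xK yK; apply: (Phi_max (x, y)); rewrite inE.
have P10 : Phi x1 y1 <= Phi x0 y0 by exact: max0.
have maxoc x y : cube_oc x -> cube_oc y -> Phi x y <= Phi x0 y0.
  move=> xc yc; have [P|P] := leP (Phi x y) 0; first lra.
  by have [] := inK x y xc yc P; exact: max0.
by exists x0, y0; split=> // *; try exact: Koc; apply: maxoc => //; exact: Koc.
Qed.

(** The size of [e] is such that the logarithmic terms use up less than half of
    the excess [s] of [w x1 - w y1] over the Lipschitz bound. *)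
Lemma P3_solution_lipschitz (M : R) (x1 y1 : 'rV[R]_n) :
  (forall x, cube_oc x -> w x <= M) -> cube_oc x1 -> cube_oc y1 ->
  w x1 - w y1 <= L * enorm (x1 - y1).
Proof.
move=> wM x1c y1c; rewrite leNgt; apply/negP => gap.
pose r := enorm (x1 - y1).
have r0 : 0 < r.
  apply: enormB_gt0; apply: contraTneq gap => ->.
  by rewrite -leNgt subrr mulr_ge0 // enorm_ge0.
pose s := w x1 - w y1 - L * r.
have s0 : 0 < s by rewrite subr_gt0.
pose S := - (log_sum x1 + log_sum y1).
have S0 : 0 <= S.
  by rewrite oppr_ge0; have := log_sum_le0 x1c; have := log_sum_le0 y1c; lra.
have nR : 0 < n%:R :> R by rewrite ltr0n.
have D0 : 0 < 8 * (n%:R + S + 1) by lra.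
pose e := s / (8 * (n%:R + S + 1)).
have e0 : 0 < e by rewrite divr_gt0.
have eE : e * n%:R + e * S + e = s / 8.
  by rewrite /e; field; rewrite gt_eqF //; lra.
have en : 0 < e * n%:R by rewrite mulr_gt0.
have eS : 0 <= e * S by rewrite mulr_ge0 // ltW.
(* With this weight [k d^2 + L r / 2 >= L d] for all [d], and equality holds at
   [d = r], the distance between [x1] and [y1]. *)
pose k := L / (2 * r).
have k0 : 0 <= k by rewrite divr_ge0 // mulr_ge0 // ltW.
have kr : k * r ^+ 2 = L * r / 2 by rewrite /k; field; rewrite gt_eqF.
have [|x0 [y0 [x0c y0c P10 maxx maxy]]] :=
    P3_solution_doubling k0 e0 wM x1c y1c.
  rewrite -/r kr; have -> : e * log_sum x1 = - (e * S) - e * log_sum y1.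
    by rewrite /S; ring.
  have Lr : 0 <= L * r by rewrite mulr_ge0 // ltW.
  move: eE; rewrite /s; lra.
pose d := enorm (x0 - y0).
have d0 : 0 <= d by exact: enorm_ge0.
pose delta := w x0 - w y0.
have delta_gt : L * d + s * (7 / 8) <= delta.
  have young : L * d <= k * d ^+ 2 + L * r / 2.
    have : 0 <= k * (d - r) ^+ 2 by rewrite mulr_ge0 // sqr_ge0.
    have -> : k * (d - r) ^+ 2 = k * d ^+ 2 + L * r / 2 - L * d.
      by rewrite /k; field; rewrite gt_eqF.
    by rewrite subr_ge0.
  have lx0 : e * log_sum x0 <= 0 by rewrite pmulr_rle0 // log_sum_le0.
  have ly0 : e * log_sum y0 <= 0 by rewrite pmulr_rle0 // log_sum_le0.
  move: P10; rewrite -/r -/d kr.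
  have -> : e * log_sum x1 = - (e * S) - e * log_sum y1 by rewrite /S; ring.
  move: eE; rewrite /delta /s; lra.
have hmax : local_max_rel cube_oc (fun x => w x - log_quadratic k (- e) y0 x) x0.
  rewrite /local_max_rel near_withinE; apply: filterE => x xc.
  by have := maxx x xc; rewrite !log_quadraticE; lra.
have hmin : local_min_rel cube_oc (fun y => w y - log_quadratic (- k) e x0 y) y0.
  rewrite /local_min_rel near_withinE; apply: filterE => y yc.
  have := maxy y yc; rewrite !log_quadraticE.
  rewrite -[enorm (y - x0)]enormN -[enorm (y0 - x0)]enormN !opprB.
  lra.
have sub := P3_subsolution_test hn hu hw x0c hmax.
have [F0 super] := P3_supersolution_test hn hu u_nd hw y0c hmin.
(* Each of the two logarithmic terms takes [n e] off the gap between
   corresponding factors. *)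
pose b := delta - 2 * (e * n%:R).
have b_gt : L * d < b by rewrite /b; lra.
have Ld : 0 <= L * d by exact: mulr_ge0.
have b0 : 0 < b by lra.
have := geometric_mean_shift hn F0 b0 (g0 y0c) (g0 x0c).
rewrite !gf // => /(_ super) shift.
have : g y0 + b <= g x0.
  apply: shift; apply: le_trans sub; apply: ler_prod => i _; apply/andP; split.
    by apply: addr_ge0 => //; exact: ltW.
  rewrite le_max; apply/orP; left; rewrite -subr_ge0.
  (* What is left of the gap comes from the quadratic penalty. *)
  rewrite (_ : _ - _ = 2 * n%:R * k * (x0 ord0 i - y0 ord0 i) ^+ 2).
    by rewrite mulr_ge0 ?sqr_ge0 // mulr_ge0 // mulr_ge0 ?ler0n.
  by rewrite /b /delta; ring.
have := gL x0c y0c; rewrite -/d ler_norml => /andP[_]; lra.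
Qed.

End comparison.

(** * The extension to the closed cube *)

Theorem lemma4p8 (R : realType) (n : nat) (hn : (1 <= n)%N)
    (f w : 'rV[R]_n -> R)
    (f_ge0 : forall x, cube x -> 0 <= f x)
    (f_lip : C01 cube (nth_root f))
    (hw : maximal_bounded_solution_P3 f w) :
  exists W : 'rV[R]_n -> R,
    [/\ forall x, cube_oc x -> W x = w x,
        C01 cube W &
        (lip_seminorm cube W
           <= (Num.sqrt n%:R)%:E * lip_seminorm cube (nth_root f))%E].
Proof.
have [u [hu u_nd wE]] := hw.
set g := nth_root f in f_lip *.
have [L gE L0] : exists2 L : R, lip_seminorm cube g = L%:E & 0 <= L.
  have := lip_seminorm_cube_ge0 g hn; move: f_lip; rewrite /C01.
  by case: (lip_seminorm cube g) => [L| |] // _; rewrite lee_fin => L0; exists L.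
have gL := lip_seminorm_lipschitz gE.
have g0 x : 0 <= g x by exact: powR_ge0.
have gf x : cube_oc x -> g x ^+ n = f x.
  move=> /cube_oc_sub xc; rewrite /g /nth_root -powR_mulrn ?powR_ge0 // -powRrM.
  by rewrite mulVf ?powRr1 ?f_ge0 // pnatr_eq0 -lt0n.
pose one : 'rV[R]_n := const_mx 1.
have one_oc : cube_oc one by move=> i; rewrite mxE ltr01 lexx.
have one_c := cube_oc_sub one_oc.
pose M := g one + L * Num.sqrt n%:R.
have M0 : 0 <= M by rewrite addr_ge0 // mulr_ge0 // sqrtr_ge0.
have fM x : cube_oc x -> f x <= M ^+ n.
  move=> xoc; have xc := cube_oc_sub xoc; rewrite -gf // lerXn2r ?nnegrE //.
  have diam : enorm (x - one) <= Num.sqrt n%:R.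
    rewrite ler_sqrt ?ler0n // (_ : n%:R = \sum_(i < n) 1); last first.
      by rewrite sumr_const card_ord.
    apply: ler_sum => i _; rewrite !mxE.
    by have /andP[? ?] := xc i; nra.
  have := gL x one xc one_c; rewrite ler_norml => /andP[_].
  by have := ler_wpM2l L0 diam; rewrite /M; lra.
have wM x : cube_oc x -> w x <= 2 * (M + 1).
  exact: P3_solution_le hn hu wE M0 fM x.
have wL x y : cube_oc x -> cube_oc y -> w x - w y <= L * enorm (x - y).
  apply: (P3_solution_lipschitz hn hu u_nd wE _ gf L0 _ wM) => // a b ac bc.
  by apply: gL; exact: cube_oc_sub.
have [W [Ww WL]] := lipschitz_extension (ex_intro _ one one_oc) L0 wL.
have WLe : (lip_seminorm cube W <= L%:E)%E by apply: lip_seminorm_le => x y _ _.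
exists W; split=> //; first exact: le_lt_trans WLe (ltry L).
rewrite gE; apply: le_trans WLe _; rewrite -EFinM lee_fin ler_peMl //.
by rewrite -[leLHS]sqrtr1 ler_sqrt ?ler0n // ler1n.
Qed.
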